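(* Let $n\in\mathbb{N}$ and let $i\in\mathbb{N}$ with $2\le i\le 2^n$. Let $f\in\mathbb{Q}^n\setminus\mathbb{Z}^n$, and let $s$ be the denominator of $f$. If $i\le n$, then $\rho_f(\mathcal{L}_i^n,\mathcal{L}_{i+1}^n)=\infty$. If $i>n$, then $\rho_f(\mathcal{L}_i^n,\mathcal{L}_*^n)\le\operatorname{Flt}(n)4^{n-1}s$.
   Context: The denominator of $u\in\mathbb{Q}^n\setminus\{0\}$ is the minimal $s\in\mathbb{N}$ with $su\in\mathbb{Z}^n$. $\mathcal{C}^n$ is the family of all $n$-dimensional closed convex subsets of $\mathbb{R}^n$. A set $B\subseteq\mathbb{R}^n$ is lattice-free if $B\in\mathcal{C}^n$ and $\operatorname{int}(B)\cap\mathbb{Z}^n=\emptyset$. For $i\in\mathbb{N}$, $\mathcal{L}_i^n$ is the family of all lattice-free polyhedra in $\mathbb{R}^n$ with at most $i$ facets, and $\mathcal{L}_*^n$ is the family of all lattice-free polyhedra in $\mathbb{R}^n$. For $B\in\mathcal{C}^n$ with $0\in\operatorname{int}(B)$, $\psi_B(r)=\inf\{\lambda>0:r\in\lambda B\}$. For $k\in\mathbb{N}$, $R=(r_1,\dots,r_k)\in\mathbb{R}^{n\times k}$, $f\in\mathbb{R}^n\setminus\mathbb{Z}^n$, $B\in\mathcal{C}^n$: if $f\in\operatorname{int}(B)$, $C_B(R,f)=\{s\in\mathbb{R}^k_{\ge0}:\sum_j s_j\psi_{B-f}(r_j)\ge1\}$, otherwise $C_B(R,f)=\mathbb{R}^k_{\ge0}$;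 for $\mathcal{B}\subseteq\mathcal{C}^n$, $C_{\mathcal{B}}(R,f)=\bigcap_{B\in\mathcal{B}}C_B(R,f)$ ($=\mathbb{R}^k_{\ge0}$ if $\mathcal{B}=\emptyset$). For $\mathcal{B},\mathcal{L}\subseteq\mathcal{C}^n$, $\rho_f(\mathcal{B},\mathcal{L})=\inf\{\alpha>0: C_{\mathcal{B}}(R,f)\subseteq\frac1\alpha C_{\mathcal{L}}(R,f)$ for all $k$ and all $R\in\mathbb{R}^{n\times k}\}$. The lattice width of nonempty $X$ is $w(X)=\inf_{u\in\mathbb{Z}^n\setminus\{0\}}(\sup_{x\in X}u\cdot x-\inf_{x\in X}u\cdot x)$, and $\operatorname{Flt}(n)=\sup\{w(B):B$ lattice-free in $\mathbb{R}^n\}$ (finite). *)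

(* Defs.v *)
From HB Require Import structures.
From mathcomp Require Import all_boot all_order all_algebra.
From mathcomp Require Import all_classical all_reals all_analysis.
Set Implicit Arguments. Unset Strict Implicit. Unset Printing Implicit Defensive.
Import Order.TTheory GRing.Theory Num.Theory.
Import numFieldNormedType.Exports.
Local Open Scope classical_set_scope.
Local Open Scope ring_scope.

Section Defs.
Variable R : realType.

Definition dotv (n : nat) (u x : 'rV[R]_n) : R := \sum_(j < n) u 0 j * x 0 j.

Definition intvec (n : nat) (x : 'rV[R]_n) : Prop := forall j, x 0 j \is a Num.int.

Definition ratvec (n : nat) (u : 'rV[R]_n) : Prop :=
  exists s : nat, (0 < s)%N /\ intvec (s%:R *: u).

Definition denominator_of (n : nat) (u : 'rV[R]_n) (s : nat) : Prop :=
  [/\ (0 < s)%N, intvec (s%:R *: u) &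
      forall t : nat, (0 < t)%N -> intvec (t%:R *: u) -> (s <= t)%N].

Definition convex_set (n : nat) (B : set 'rV[R]_n) : Prop :=
  forall x y t, B x -> B y -> 0 <= t -> t <= 1 -> B ((1 - t) *: x + t *: y).

Definition affdim_ge (n : nat) (A : set 'rV[R]_n) (d : nat) : Prop :=
  exists x : 'I_d.+1 -> 'rV[R]_n,
    (forall j, A (x j)) /\
    row_free (\matrix_(j < d) (x (lift ord0 j) - x ord0)).

Definition Cn (n : nat) (B : set 'rV[R]_n) : Prop :=
  [/\ closed B, convex_set B & affdim_ge B n].

Definition lattice_free (n : nat) (B : set 'rV[R]_n) : Prop :=
  Cn B /\ (forall z, intvec z -> ~ (B°) z).

Definition polyhedron (n : nat) (P : set 'rV[R]_n) : Prop :=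
  exists (m : nat) (a : 'I_m -> 'rV[R]_n) (b : 'I_m -> R),
    P = [set x | forall j, dotv (a j) x <= b j].

Definition facet (n : nat) (P F : set 'rV[R]_n) : Prop :=
  exists (a : 'rV[R]_n) (beta : R),
    [/\ a != 0, (forall x, P x -> dotv a x <= beta),
        F = [set x | P x /\ dotv a x = beta] & affdim_ge F n.-1].

Definition at_most_facets (n : nat) (P : set 'rV[R]_n) (i : nat) : Prop :=
  forall F : 'I_i.+1 -> set 'rV[R]_n,
    (forall j, facet P (F j)) -> exists j1 j2, j1 != j2 /\ F j1 = F j2.

Definition Lfam (n i : nat) : set (set 'rV[R]_n) :=
  [set B | [/\ lattice_free B, polyhedron B & at_most_facets B i]].
Definition Lstar (n : nat) : set (set 'rV[R]_n) :=
  [set B | lattice_free B /\ polyhedron B].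

Definition gauge (n : nat) (B : set 'rV[R]_n) (f r : 'rV[R]_n) : R :=
  inf [set l : R | 0 < l /\ exists b, B b /\ r = l *: (b - f)].

(* C_B(R,f), with R given by its columns r_1..r_k *)
Definition CB (n k : nat) (B : set 'rV[R]_n) (r : 'I_k -> 'rV[R]_n)
    (f : 'rV[R]_n) : set 'rV[R]_k :=
  if `[< (B°) f >] then
    [set s | (forall j, 0 <= s 0 j) /\ 1 <= \sum_(j < k) s 0 j * gauge B f (r j)]
  else [set s | forall j, 0 <= s 0 j].

(* C_calB(R,f) : intersection (= R^k_{>=0} if the family is empty) *)
Definition Cfam (n k : nat) (Bs : set (set 'rV[R]_n)) (r : 'I_k -> 'rV[R]_n)
    (f : 'rV[R]_n) : set 'rV[R]_k :=
  [set s : 'rV[R]_k | (forall j, 0 <= s 0 j) /\ forall B, Bs B -> CB B r f s].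

(* rho_f(calB, calL) in the extended reals (inf of the empty set is +oo) *)
Definition rho (n : nat) (f : 'rV[R]_n) (Bs Ls : set (set 'rV[R]_n)) : \bar R :=
  ereal_inf [set a%:E | a in [set a : R | 0 < a /\
     forall (k : nat) (r : 'I_k -> 'rV[R]_n),
       Cfam Bs r f `<=` [set a^-1 *: c | c in Cfam Ls r f]]].

Definition lattice_width (n : nat) (X : set 'rV[R]_n) : \bar R :=
  ereal_inf [set (ereal_sup [set (dotv u x)%:E | x in X] -
                  ereal_inf [set (dotv u x)%:E | x in X])%E
            | u in [set u : 'rV[R]_n | intvec u /\ u != 0]].

Definition Flt (n : nat) : \bar R :=
  ereal_sup [set lattice_width B | B in [set B : set 'rV[R]_n | lattice_free B]].

End Defs.

(* Main.v *)
(** Every body in play is written [cap f A = {x | A_j (x - f) <= 1 for all j}] with [f] in its interior.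

    For [i > n], a lattice-free [B] around [f] is enclosed, up to dilation, in a lattice-free
    polyhedron with at most [n + 1] facets. Take a primitive integer direction [u] in which [B] is
    flat. If [u f] is not an integer, a split at distance at least [1 / s] from [f] does. Otherwise
    the section of [B] at level [u f] is handled by induction, and its enclosing inequalities are
    tilted so that they enclose [B] and, together with one further inequality [u (x - f) <= 1] or
    [- u (x - f) <= 1], still cut out a lattice-free polyhedron.

    For [i <= n], unimodularity reduces to [f] on a coordinate axis. Very flat pyramids, built
    recursively over a split, are lattice-free with [i + 1] facets, while any polyhedron with at most
    [i] facets whose gauge stays bounded on suitable rays contains an integer point in its interior. *)
Require Import Defs.
From HB Require Import structures.
From mathcomp Require Import all_boot all_order all_algebra.
From mathcomp Require Import all_classical all_reals all_analysis.
From mathcomp Require Import ring lra.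
Set Implicit Arguments. Unset Strict Implicit. Unset Printing Implicit Defensive.
Import Order.TTheory GRing.Theory Num.Theory.
Import numFieldNormedType.Exports.
Local Open Scope classical_set_scope.
Local Open Scope ring_scope.

(** * Dot products and integer vectors *)

Lemma dotvC (R : realType) n (u v : 'rV[R]_n) : dotv u v = dotv v u.
Proof. by apply: eq_bigr => j _; rewrite mulrC. Qed.

Lemma dotvDr (R : realType) n (u v w : 'rV[R]_n) : dotv u (v + w) = dotv u v + dotv u w.
Proof. by rewrite -big_split; apply: eq_bigr => j _; rewrite mxE mulrDr. Qed.

Lemma dotvZr (R : realType) n c (u v : 'rV[R]_n) : dotv u (c *: v) = c * dotv u v.
Proof. by rewrite mulr_sumr; apply: eq_bigr => j _; rewrite mxE mulrCA. Qed.

Lemma dotvNr (R : realType) n (u v : 'rV[R]_n) : dotv u (- v) = - dotv u v.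
Proof. by rewrite -scaleN1r dotvZr mulN1r. Qed.

Lemma dotvBr (R : realType) n (u v w : 'rV[R]_n) : dotv u (v - w) = dotv u v - dotv u w.
Proof. by rewrite dotvDr dotvNr. Qed.

Lemma dotv0r (R : realType) n (u : 'rV[R]_n) : dotv u 0 = 0.
Proof. by rewrite -(scale0r 0) dotvZr mul0r. Qed.

Lemma dotvDl (R : realType) n (u v w : 'rV[R]_n) : dotv (u + v) w = dotv u w + dotv v w.
Proof. by rewrite -!(dotvC w) dotvDr. Qed.

Lemma dotvZl (R : realType) n c (u v : 'rV[R]_n) : dotv (c *: u) v = c * dotv u v.
Proof. by rewrite -!(dotvC v) dotvZr. Qed.

Lemma dotvNl (R : realType) n (u v : 'rV[R]_n) : dotv (- u) v = - dotv u v.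
Proof. by rewrite -!(dotvC v) dotvNr. Qed.

Lemma dotv0l (R : realType) n (u : 'rV[R]_n) : dotv 0 u = 0.
Proof. by rewrite dotvC dotv0r. Qed.

Lemma dotv_suml (R : realType) n (I : finType) (F : I -> 'rV[R]_n) v :
  dotv (\sum_i F i) v = \sum_i dotv (F i) v.
Proof.
rewrite /dotv exchange_big /=; apply: eq_bigr => j _.
by rewrite summxE mulr_suml.
Qed.

Lemma dotv_sumr (R : realType) n (I : finType) (F : I -> 'rV[R]_n) v :
  dotv v (\sum_i F i) = \sum_i dotv v (F i).
Proof. by rewrite dotvC dotv_suml; apply: eq_bigr => i _; rewrite dotvC. Qed.

Lemma dotvE (R : realType) n (u v : 'rV[R]_n) : dotv u v = (u *m v^T) 0 0.
Proof. by rewrite mxE; apply: eq_bigr => j _; rewrite mxE. Qed.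

Lemma dotvv_gt0 (R : realType) n (a : 'rV[R]_n) : a != 0 -> 0 < dotv a a.
Proof.
have sq_ge0 j : 0 <= a 0 j * a 0 j by rewrite -expr2 sqr_ge0.
move=> a0; rewrite lt_neqAle sumr_ge0 // andbT eq_sym psumr_eq0 //.
apply: contra a0 => /allP a0; apply/eqP/rowP => j; rewrite mxE.
by have := a0 j (mem_index_enum j); rewrite /= mulf_eq0 orbb => /eqP.
Qed.

Lemma dotv_int (R : realType) n (u v : 'rV[R]_n) :
  intvec u -> intvec v -> dotv u v \is a Num.int.
Proof. by move=> ui vi; apply: rpred_sum => j _; apply: rpredM. Qed.

Lemma intvecD (R : realType) n (u v : 'rV[R]_n) : intvec u -> intvec v -> intvec (u + v).
Proof. by move=> ui vi j; rewrite mxE rpredD. Qed.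

Lemma intvecZ (R : realType) n (c : R) (v : 'rV[R]_n) :
  c \is a Num.int -> intvec v -> intvec (c *: v).
Proof. by move=> ci vi j; rewrite mxE rpredM. Qed.

Lemma intvecN (R : realType) n (v : 'rV[R]_n) : intvec v -> intvec (- v).
Proof. by move=> vi j; rewrite mxE rpredN. Qed.

(** * Continuity, interiors and affine dimension *)

Lemma dotv_continuous (R : realType) n (a : 'rV[R]_n) : continuous (dotv a).
Proof.
move=> x; rewrite /dotv; apply: (@cvg_big R _ +%R 0 xpredT add_continuous _ (nbhs x)) => j _.
by apply: cvgM; [exact: cvg_cst|exact: coord_continuous].
Qed.

Lemma interior_radial (R : realType) n (B : set 'rV[R]_n) (f v : 'rV[R]_n) :
  B° f -> exists2 e, 0 < e & forall t, `|t| <= e -> B (f + t *: v).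
Proof.
rewrite /interior /= => Bf.
have cont : (fun t : R => f + t *: v) @ (0 : R) --> f + 0 *: v.
  by apply: cvgD; [exact: cvg_cst|apply: cvgZr_tmp; exact: cvg_id].
rewrite scale0r addr0 in cont.
have /nbhs_ballP[e /= e0 He] := cont _ Bf.
exists (e / 2); first by rewrite divr_gt0.
move=> t te; apply: He; rewrite /ball /= sub0r normrN.
by apply: le_lt_trans te _; rewrite ltr_pdivrMr // ltr_pMr // ltr1n.
Qed.

(** The homothety centred at the pushed point that takes [z] to [f] pulls a neighbourhood of [f] in
    [B] back to a neighbourhood of [z], which lies in [B] by convexity. *)
Lemma interior_pushed (R : realType) n (B : set 'rV[R]_n) (f z : 'rV[R]_n) (e : R) :
  Defs.convex_set B -> B° f -> 0 < e -> B (f + (1 + e) *: (z - f)) -> B° z.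
Proof.
move=> cB Bf e0 By.
have e1 : 0 < 1 + e by rewrite addr_gt0.
set y := f + _ in By; set th := (1 + e)^-1.
have th0 : 0 < th by rewrite invr_gt0.
have th1 : th < 1 by rewrite invf_lt1 // ltrDl.
have th1' : 0 < 1 - th by rewrite subr_gt0.
pose g x := (1 - th)^-1 *: (x - th *: y).
have gz : g z = f.
  rewrite /g.
  have -> : z - th *: y = (1 - th) *: f.
    by apply/rowP => j; rewrite !mxE /th; field; rewrite gt_eqF.
  by rewrite scalerA mulVf ?scale1r // gt_eqF.
have cont : g @ z --> f.
  rewrite -gz; apply: (@cvgZl_tmp _ _ _ (nbhs z) _ _ (fun x => x - th *: y)).
  by apply: cvgB; [exact: cvg_id|exact: cvg_cst].
have := cont _ Bf; apply: (@filterS _ (nbhs z)) => x /= Bgx.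
have := cB (g x) y th Bgx By (ltW th0) (ltW th1).
by rewrite /g scalerA divff ?gt_eqF // scale1r subrK.
Qed.

Lemma affdim_ge_directions (R : realType) n d (F : set 'rV[R]_n) (y : 'rV[R]_n) (D : 'M[R]_(d, n)) :
  F y -> row_free D -> (forall i, exists2 e, 0 < e & F (y + e *: row i D)) -> affdim_ge F d.
Proof.
move=> Fy Dfree dir.
have /choice[e He] : forall i, exists e, 0 < e /\ F (y + e *: row i D).
  by move=> i; have [e] := dir i; exists e.
exists (fun k => if unlift ord0 k is Some i then y + e i *: row i D else y); split.
  by move=> k; case: unliftP => // i _; case: (He i).
set M := \matrix_(j < d) _.
have -> : M = diag_mx (\row_i e i) *m D.
  apply/row_matrixP => i; rewrite rowK liftK unlift_none addrC addKr.
  by rewrite row_mul row_diag_mx mxE -scalemxAl -rowE.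
rewrite /row_free (eqmxMfull D) ?(eqP Dfree) // row_full_unit unitmxE det_diag unitfE.
by apply/prodf_neq0 => i _; rewrite mxE gt_eqF //; case: (He i).
Qed.

Lemma interior_affdim (R : realType) n (B : set 'rV[R]_n) (f : 'rV[R]_n) : B° f -> affdim_ge B n.
Proof.
move=> Bf; apply: (@affdim_ge_directions _ _ _ _ f 1%:M).
- exact: interior_subset Bf.
- by rewrite row_free_unit unitmx1.
- move=> i; have [e e0 He] := interior_radial (row i 1%:M) Bf.
  by exists e => //; apply: He; rewrite gtr0_norm.
Qed.

(** * Polyhedra described by inequalities normalised at an interior point *)

Definition cap (R : realType) n (f : 'rV[R]_n) m (A : 'I_m -> 'rV[R]_n) : set 'rV[R]_n :=
  [set x | forall j, dotv (A j) (x - f) <= 1].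

Definition integer_free (R : realType) n (f : 'rV[R]_n) m (A : 'I_m -> 'rV[R]_n) :=
  forall z, intvec z -> exists j, 1 <= dotv (A j) (z - f).

(** Dually, no direction makes every [A j] negative; the weights are what a later lifting
    combines. *)
Definition balanced (R : realType) n m (A : 'I_m -> 'rV[R]_n) :=
  exists l : 'I_m -> R,
    [/\ forall j, 0 <= l j, \sum_j l j = 1 & \sum_j l j *: A j = 0].

Lemma interior_cap (R : realType) n (f : 'rV[R]_n) m (A : 'I_m -> 'rV[R]_n) z :
  (forall j, dotv (A j) (z - f) < 1) -> (cap f A)° z.
Proof.
move=> zA.
have near_z : \forall x \near z, forall j, dotv (A j) (x - f) < 1.
  apply: (@filter_forall _ _ (fun j x => dotv (A j) (x - f) < 1) (nbhs z)) => j.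
  have : dotv (A j) @ z --> dotv (A j) z by exact: dotv_continuous.
  move/cvgr_lt/(_ (1 + dotv (A j) f)); rewrite -ltrBlDr -dotvBr => /(_ (zA j)).
  by apply: (@filterS _ (nbhs z)) => x; rewrite dotvBr ltrBlDr.
by apply: (@filterS _ (nbhs z)) near_z => x xA j; exact: ltW.
Qed.

Lemma interior_cap_center (R : realType) n (f : 'rV[R]_n) m (A : 'I_m -> 'rV[R]_n) :
  (cap f A)° f.
Proof. by apply: interior_cap => j; rewrite subrr dotv0r ltr01. Qed.

Lemma cap_closed (R : realType) n (f : 'rV[R]_n) m (A : 'I_m -> 'rV[R]_n) :
  closed (cap f A).
Proof.
have -> : cap f A =
    \bigcap_(j in [set: 'I_m]) (dotv (A j) @^-1` [set t | t <= 1 + dotv (A j) f]).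
  apply/seteqP; split => [x xA j _|x xA j] /=.
    by rewrite -lerBlDr -dotvBr.
  by rewrite dotvBr lerBlDr; exact: xA.
apply: closed_bigI => j _; apply: preimage_closed; last exact: closed_le.
by move=> x _; exact: dotv_continuous.
Qed.

Lemma cap_convex (R : realType) n (f : 'rV[R]_n) m (A : 'I_m -> 'rV[R]_n) :
  Defs.convex_set (cap f A).
Proof.
move=> x y t xA yA t0 t1 j.
have -> : (1 - t) *: x + t *: y - f = (1 - t) *: (x - f) + t *: (y - f).
  by apply/rowP => k; rewrite !mxE; ring.
rewrite dotvDr !dotvZr -[leRHS](subrK t 1) lerD //.
  by rewrite ler_piMr ?subr_ge0.
by rewrite ler_piMr.
Qed.

Lemma cap_polyhedron (R : realType) n (f : 'rV[R]_n) m (A : 'I_m -> 'rV[R]_n) :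
  polyhedron (cap f A).
Proof.
exists m, A, (fun j => 1 + dotv (A j) f).
by apply/seteqP; split => x xA j; have := xA j; rewrite dotvBr lerBlDr.
Qed.

(** Pushing an interior integer point slightly further from [f] would violate the inequality that is
    at least [1] there. *)
Lemma cap_lattice_free (R : realType) n (f : 'rV[R]_n) m (A : 'I_m -> 'rV[R]_n) :
  integer_free f A -> lattice_free (cap f A).
Proof.
move=> Afree; split.
  split; [exact: cap_closed|exact: cap_convex|].
  exact: interior_affdim (interior_cap_center f A).
move=> z zint zcap; have [j Aj] := Afree z zint.
have [e e0 /(_ e)] := interior_radial (z - f) zcap.
rewrite gtr0_norm // => /(_ (lexx _)) /(_ j).
by rewrite addrAC dotvDr dotvZr; nra.
Qed.

Lemma orthogonal_parallel (R : realType) n (D : 'M[R]_(n.-1, n)) (a b : 'rV[R]_n) :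
  (0 < n)%N -> row_free D -> (forall i, dotv (row i D) a = 0) ->
  (forall i, dotv (row i D) b = 0) -> b != 0 -> exists c, a = c *: b.
Proof.
move=> n0 Dfree Da Db b0.
have sub_ker c : (forall i, dotv (row i D) c = 0) -> (c <= kermx D^T)%MS.
  move=> Dc; apply/sub_kermxP/rowP => i; rewrite !mxE -[RHS](Dc i).
  by apply: eq_bigr => k _; rewrite !mxE mulrC.
have rk : \rank (kermx D^T) = 1%N.
  rewrite mxrank_ker mxrank_tr (eqP Dfree).
  by case: {+}n n0 => // k _; rewrite subSnn.
apply/sub_rVP; apply: submx_trans (sub_ker _ Da) _.
by rewrite -(mxrank_leqif_sup (sub_ker _ Db)) rk rank_rV b0.
Qed.

(* A face on which no single inequality is identically tight contains, by averaging, a point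
   where all are strict, i.e. an interior point of the polyhedron. *)
Lemma facet_cap (R : realType) n (f : 'rV[R]_n) m (A : 'I_m -> 'rV[R]_n) F :
  (0 < n)%N -> facet (cap f A) F ->
  exists j, F = [set x | cap f A x /\ dotv (A j) (x - f) = 1].
Proof.
move=> n0 [a [beta [a0 aval FE [x [xF xfree]]]]].
have FP y : F y -> cap f A y by rewrite FE => -[].
have Fa y : F y -> dotv a y = beta by rewrite FE => -[].
have [j Fj] : exists j, forall y, F y -> dotv (A j) (y - f) = 1.
  apply: contrapT => /forallNP noj.
  have /choice[y yP] : forall j, exists y, F y /\ dotv (A j) (y - f) < 1.
    move=> j; have /existsNP[y /not_implyP[Fy /eqP Ay]] := noj j.
    by exists y; split => //; rewrite lt_neqAle Ay; exact: FP.
  pose c := m.+1%:R^-1 *: (x ord0 + \sum_j y j).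
  have m0 : 0 < m.+1%:R :> R by rewrite ltr0n.
  have cE b r : dotv b (x ord0) + \sum_j dotv b (y j) = m.+1%:R * r -> dotv b c = r.
    by move=> e; rewrite /c dotvZr dotvDr dotv_sumr e mulKf // lt0r_neq0.
  have ca : dotv a c = beta.
    apply: cE; rewrite (eq_bigr (fun _ => beta)); last by move=> j _; exact: Fa (yP j).1.
    by rewrite (Fa _ (xF ord0)) sumr_const card_ord -mulrS mulr_natl.
  have cA j : dotv (A j) (c - f) < 1.
    have -> : c - f = m.+1%:R^-1 *: ((x ord0 - f) + \sum_j (y j - f)).
      rewrite sumrB sumr_const card_ord addrACA -opprD -mulrS scalerBr.
      by rewrite -[f *+ _]scaler_nat scalerA mulVf ?scale1r // lt0r_neq0.
    rewrite dotvZr dotvDr dotv_sumr mulrC ltr_pdivrMr // mul1r -nat1r.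
    apply: ler_ltD; first exact: FP.
    rewrite -[X in _ < X%:R]card_ord -sumr_const (bigD1 j) //= [ltRHS](bigD1 j) //=.
    by apply: ltr_leD; [exact: (yP j).2|apply: ler_sum => k _; exact/FP/(yP k).1].
  (* The functional [a] would attain its maximum [beta] at an interior point, yet it grows along
     [a]. *)
  clearbody c; have [e e0 /(_ e)] := interior_radial a (interior_cap cA).
  rewrite gtr0_norm // => /(_ (lexx _)) /aval.
  by rewrite dotvDr dotvZr ca; have := dotvv_gt0 a0; nra.
exists j.
have Aj0 : A j != 0.
  by apply/eqP => A0; have := Fj _ (xF ord0); rewrite A0 dotv0l => /eqP; rewrite eq_sym oner_eq0.
(* Both normals are orthogonal to the [n.-1] independent differences inside the facet, so they are
   proportional. *)
have [||c ac] := orthogonal_parallel n0 xfree _ _ Aj0 (a := a).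
- by move=> i; rewrite rowK dotvC dotvBr !Fa // subrr.
- move=> i; rewrite rowK dotvC.
  by move: (Fj _ (xF (lift ord0 i))) (Fj _ (xF ord0)); rewrite !dotvBr; lra.
have c0 : c != 0 by apply: contraNneq a0 => c0; rewrite ac c0 scale0r.
have key y : dotv a y - beta = c * (dotv (A j) (y - f) - 1).
  rewrite -(Fa _ (xF ord0)) -(Fj _ (xF ord0)) -!dotvBr ac dotvZl.
  by congr (_ * dotv _ _); rewrite opprB addrA subrK.
rewrite FE; apply/seteqP; split => y [yP ya]; split => //; apply/eqP.
  by have /eqP := key y; rewrite ya subrr eq_sym mulf_eq0 (negPf c0) /= subr_eq0.
by rewrite -subr_eq0 key ya subrr mulr0.
Qed.

(** Each facet is determined by an inequality that cuts it out; the pigeonhole principle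
    concludes. *)
Lemma cap_at_most_facets (R : realType) n (f : 'rV[R]_n) m (A : 'I_m -> 'rV[R]_n) i :
  (0 < n)%N -> (m <= i)%N -> at_most_facets (cap f A) i.
Proof.
move=> n0 mi F Ffacet.
have /choice[h hP] := fun k => facet_cap n0 (Ffacet k).
have /injectivePn[j1 [j2 j12 hj]] : ~~ injectiveb h.
  apply: contraL mi => /injectiveP hinj.
  by have := leq_card h hinj; rewrite !card_ord -ltnNge.
by exists j1, j2; split => //; rewrite !hP hj.
Qed.

Lemma cap_Lfam (R : realType) n (f : 'rV[R]_n) m (A : 'I_m -> 'rV[R]_n) i :
  (0 < n)%N -> (m <= i)%N -> integer_free f A -> Lfam i (cap f A).
Proof.
move=> n0 mi Afree; split.
- exact: cap_lattice_free.
- exact: cap_polyhedron.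
- exact: cap_at_most_facets.
Qed.

(** * Unimodular frames, splits, lifted systems and extension of inequalities *)

Lemma int_ltD1 (R : realType) (x y : R) :
  x \is a Num.int -> y \is a Num.int -> x < y -> x + 1 <= y.
Proof.
move=> /intrP[a ->] /intrP[b ->].
by rewrite ltr_int -[1]/(1%:~R) -intrD ler_int lezD1.
Qed.

(** Smith normal form of the one-row matrix [a] makes it a multiple of the first row of a unimodular
    [U]; the columns of the inverse of [U] form the dual basis [y]. *)
Lemma unimodular_frame (R : realType) n (a : 'rV[R]_n.+1) : intvec a ->
  exists (e y : 'I_n.+1 -> 'rV[R]_n.+1) (d : R),
    [/\ forall j, intvec (e j), forall j, intvec (y j),
        forall j k, dotv (y j) (e k) = (j == k)%:R,
        d \is a Num.int & a = d *: e ord0].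
Proof.
move=> aint; pose M := map_mx Num.floor a.
have [L Lu [U Uu [d _ ME]]] := int_Smith_normal_form M.
pose toR k l (X : 'M[int]_(k, l)) : 'M[R]_(k, l) := map_mx intr X.
have rowE : M = (L 0 0 * d`_0) *: row ord0 U.
  rewrite ME; apply/rowP => j; rewrite !mxE (bigD1 ord0) //= big1 => [|k k0].
    by rewrite !mxE big_ord1 !mxE /= mulr1n addr0.
  rewrite !mxE big_ord1 !mxE /= eq_sym; move: k0; rewrite -val_eqE /= => /negPf ->.
  by rewrite mulr0n mulr0 mul0r.
exists (fun j => row j (toR _ _ U)), (fun j => (col j (toR _ _ (invmx U)))^T).
exists (L 0 0 * d`_0)%:~R; split.
- by move=> j k; rewrite !mxE.
- by move=> j k; rewrite !mxE.
- move=> j k.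
  have <- : (toR _ _ U *m toR _ _ (invmx U)) k j = (j == k)%:R.
    by rewrite -map_mxM mulmxV // map_mx1 mxE eq_sym.
  by rewrite mxE; apply: eq_bigr => i _; rewrite !mxE mulrC.
- exact: intr_int.
- apply/rowP => j; rewrite !mxE -intrM.
  have /rowP/(_ j) := rowE; rewrite !mxE => <-.
  by apply/eqP; rewrite eq_sym -intrEfloor.
Qed.

(** Tilting along [u] changes no old inequality on the hyperplane [dotv u (x - f) = 0]. *)
Definition lift_system (R : realType) n m (A : 'I_m -> 'rV[R]_n) (d : 'I_m -> R)
    (u : 'rV[R]_n) (j : 'I_m.+1) : 'rV[R]_n :=
  if unlift ord0 j is Some k then A k + d k *: u else u.

(* A combination of the lifted inequalities with weights [l] shows that no point [x] with
   [dotv u (x - f) <= -1] satisfies all of them strictly. *)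
Lemma lift_systemP (R : realType) n (f : 'rV[R]_n) m (A : 'I_m -> 'rV[R]_n)
    (l d : 'I_m -> R) (u : 'rV[R]_n) :
  integer_free f A -> (forall j, 0 <= l j) -> \sum_j l j = 1 ->
  \sum_j l j *: A j = 0 -> intvec u -> dotv u f \is a Num.int ->
  \sum_j l j * d j <= -1 ->
  integer_free f (lift_system A d u) /\ balanced (lift_system A d u).
Proof.
move=> Afree l0 l1 lA uint ufint.
set s := \sum_j l j * d j => s1; split.
  move=> z zint; apply: contrapT => /forallNP noj.
  pose t := dotv u (z - f).
  have tint : t \is a Num.int by rewrite /t dotvBr rpredB // dotv_int.
  have t1 : t < 1.
    by have := noj ord0; rewrite /lift_system unlift_none => /negP; rewrite -ltNge.
  have Aj j : dotv (A j) (z - f) + d j * t < 1.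
    have := noj (lift ord0 j); rewrite /lift_system liftK => /negP.
    by rewrite -ltNge dotvDl dotvZl.
  have [t0|t0] := eqVneq t 0.
    by have [j] := Afree z zint; move: (Aj j); rewrite t0 mulr0 addr0 ltNge => /negPf ->.
  have tN1 : t <= -1.
    have t_le0 : t <= 0.
      by rewrite leNgt; apply/negP => /(int_ltD1 (rpred0 _) tint); rewrite add0r leNgt t1.
    have /(int_ltD1 tint (rpred0 _)) : t < 0 by rewrite lt_neqAle t0.
    lra.
  (* These weighted slacks are nonnegative, but their sum [1 - s * t] is at most [0] because [s] and
     [t] are at most [-1]; so all vanish, which forces every weight to be [0]. *)
  pose g j := l j * (1 - (dotv (A j) (z - f) + d j * t)).
  have g0 j : 0 <= g j by rewrite mulr_ge0 // subr_ge0 ltW.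
  have gsum : \sum_j g j = 1 - s * t.
    rewrite /g (eq_bigr (fun j => l j - (dotv (l j *: A j) (z - f) + l j * d j * t))).
      by rewrite sumrB big_split /= -dotv_suml lA dotv0l l1 add0r -mulr_suml.
    by move=> j _; rewrite dotvZl; ring.
  have gj0 : forall j, true -> g j = 0.
    apply: psumr_eq0P => [j _|]; first exact: g0.
    by apply/eqP; rewrite eq_le sumr_ge0 // andbT gsum; nra.
  have : \sum_j l j = 0.
    apply: big1 => j _; have /eqP := gj0 j isT.
    by rewrite mulf_eq0 subr_eq0 [1 == _]eq_sym (lt_eqF (Aj j)) orbF => /eqP.
  by rewrite l1 => /eqP; rewrite oner_eq0.
have s0 : 1 - s != 0 by rewrite gt_eqF; lra.
(* With weights [l] the tilted inequalities combine to [s *: u], which weight [- s] on [u] cancels;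
   dividing by [1 - s] restores total weight one. *)
exists (fun j => if unlift ord0 j is Some k then l k / (1 - s) else - s / (1 - s)); split.
- by move=> j; case: unliftP => [k _|_]; apply: divr_ge0 => //; lra.
- rewrite big_ord_recl unlift_none (eq_bigr (fun j => l j / (1 - s))).
    by rewrite -mulr_suml l1; field.
  by move=> j _; rewrite liftK.
- rewrite big_ord_recl /lift_system !unlift_none.
  rewrite (eq_bigr (fun j => (1 - s)^-1 *: (l j *: A j) + ((l j * d j) / (1 - s)) *: u)).
    rewrite big_split /= -scaler_sumr lA scaler0 add0r -scaler_suml -mulr_suml -/s.
    by rewrite -scalerDl mulNr addNr scale0r.
  move=> j _; rewrite liftK scalerDr !scalerA.
  by congr (_ *: _ + _ *: _); ring.
Qed.

(* For [p] the fractional part of [dotv u f], these are the two sides of the split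
   [floor (dotv u f) <= dotv u x <= floor (dotv u f) + 1]. *)
Definition split_system (R : realType) n (u : 'rV[R]_n) (p : R) (j : 'I_2) : 'rV[R]_n :=
  if j == ord0 then (1 - p)^-1 *: u else - p^-1 *: u.

(** The two sides lie at consecutive integer levels of [u]; weights [1 - p] and [p] cancel the
    opposite normals. *)
Lemma split_systemP (R : realType) n (f u : 'rV[R]_n) (p : R) :
  intvec u -> 0 < p < 1 -> dotv u f - p \is a Num.int ->
  integer_free f (split_system u p) /\ balanced (split_system u p).
Proof.
move=> uint /andP[p0 p1] ufp; have q0 : 0 < 1 - p by lra.
split=> [z zint|].
  have uz : dotv u z \is a Num.int by exact: dotv_int.
  have [le_uz|gt_uz] := leP (dotv u z) (dotv u f - p).
    exists (lift ord0 ord0); rewrite /split_system /= dotvZl mulNr -mulrN mulrC.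
    by rewrite ler_pdivlMr // dotvBr; lra.
  exists ord0; rewrite /split_system eqxx dotvZl mulrC ler_pdivlMr // dotvBr.
  by have := int_ltD1 ufp uz gt_uz; lra.
exists (fun j => if j == ord0 then 1 - p else p); split.
- by move=> j; case: ifP => _; exact: ltW.
- by rewrite big_ord_recl big_ord1 /=; ring.
- rewrite big_ord_recl big_ord1 /= /split_system /= scalerA divff ?gt_eqF //.
  by rewrite scalerA mulrN divff ?gt_eqF // scaleN1r scale1r subrr.
Qed.

(* Two-dimensional Hahn-Banach. *)
Lemma extend_bound (R : realType) n (B : set 'rV[R]_n) (f a u : 'rV[R]_n) (b : R) :
  Defs.convex_set B -> B° f ->
  (forall x, B x -> dotv u (x - f) = 0 -> dotv a (x - f) <= b) -> u != 0 ->
  exists c, forall x, B x -> dotv a (x - f) + c * dotv u (x - f) <= b.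
Proof.
move=> cB Bf Bb u0.
have [e e0 He] := interior_radial u Bf.
have uu := dotvv_gt0 u0.
have pos : B (f + e *: u) by apply: He; rewrite gtr0_norm.
have neg : B (f + (- e) *: u) by apply: He; rewrite normrN gtr0_norm.
(* An admissible [c] lies above these quotients, taken where [dotv u (x - f) < 0], and below their
   analogues on the positive side; [sup S] qualifies. *)
pose S := [set (dotv a (x - f) - b) / - dotv u (x - f) | x in [set x | B x /\ dotv u (x - f) < 0]].
have cross x y : B x -> dotv u (x - f) < 0 -> B y -> 0 < dotv u (y - f) ->
    (dotv a (x - f) - b) / - dotv u (x - f) <= (b - dotv a (y - f)) / dotv u (y - f).
  move=> Bx ux By uy; set p := dotv u (x - f) in ux *; set q := dotv u (y - f) in uy *.
  have pq : 0 < q - p by lra.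
  (* At parameter [t] the segment from [x] to [y] meets the hyperplane where the bound is known. *)
  pose t := - p / (q - p).
  have t0 : 0 <= t by apply: divr_ge0; lra.
  have t1 : t <= 1 by rewrite ler_pdivrMr //; lra.
  have zE v : dotv v ((1 - t) *: x + t *: y - f) = (1 - t) * dotv v (x - f) + t * dotv v (y - f).
    by rewrite !(dotvBr, dotvDr, dotvZr); ring.
  have := Bb _ (cB x y t Bx By t0 t1); rewrite !zE -/p -/q.
  have -> : (1 - t) * p + t * q = 0 by rewrite /t; field; rewrite gt_eqF.
  move=> /(_ erefl) h; rewrite ler_pdivrMr ?oppr_gt0 // mulrAC ler_pdivlMr //.
  have tE : t * (q - p) = - p by rewrite /t divfK // gt_eqF.
  have := ler_wpM2r (ltW pq) h.
  have -> : ((1 - t) * dotv a (x - f) + t * dotv a (y - f)) * (q - p) =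
    (q - p) * dotv a (x - f) + (t * (q - p)) * (dotv a (y - f) - dotv a (x - f)) by ring.
  by rewrite tE; nra.
have uneg : dotv u (f + (- e) *: u - f) < 0 by rewrite addrAC subrr add0r dotvZr; nra.
have upos : 0 < dotv u (f + e *: u - f) by rewrite addrAC subrr add0r dotvZr; nra.
have S0 : S !=set0 by eexists; exists (f + (- e) *: u).
have Sub : has_sup S.
  split => //; eexists => _ [x [Bx ux] <-]; exact: cross Bx ux pos upos.
exists (sup S) => x Bx.
have [ux|ux|ux] := ltgtP (dotv u (x - f)) 0.
- have : (dotv a (x - f) - b) / - dotv u (x - f) <= sup S.
    by apply: ub_le_sup; [exact: Sub.2|exists x].
  by rewrite ler_pdivrMr ?oppr_gt0 //; lra.
- have : sup S <= (b - dotv a (x - f)) / dotv u (x - f).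
    by apply: ge_sup => // _ [y [By uy] <-]; exact: cross.
  by rewrite ler_pdivlMr //; lra.
- by rewrite ux mulr0 addr0; exact: Bb.
Qed.

(** * Enclosing a lattice-free set in a polyhedron with few facets *)

(** Projecting along [w] onto the level of [f] keeps integer points integer, so an interior integer
    point of [B1] would project to one of [B]. *)
Lemma flattening_lattice_free (R : realType) n (B : set 'rV[R]_n) (f u w : 'rV[R]_n) :
  lattice_free B -> B° f -> intvec u -> intvec w -> dotv u w = 1 ->
  dotv u f \is a Num.int ->
  let B1 := [set x | B (x - dotv u (x - f) *: w)] in lattice_free B1 /\ B1° f.
Proof.
move=> [[clB cB _] Bfree] Bf uint wint uw ufint B1.
pose g x := x - dotv u (x - f) *: w.
have gcont : continuous g.
  move=> x; apply: (@cvgB _ _ _ (nbhs x)); first exact: cvg_id.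
  apply: cvgZr_tmp; apply: (@cvg_comp _ _ _ (fun y => y - f) (dotv u) (nbhs x) (nbhs (x - f))).
    by apply: cvgB; [exact: cvg_id|exact: cvg_cst].
  exact: dotv_continuous.
have gf : g f = f by rewrite /g subrr dotv0r scale0r subr0.
have B1f : B1° f.
  have : nbhs (g f) B by rewrite gf.
  exact: gcont.
split=> //; split.
  split; last exact: interior_affdim B1f.
    by apply: (preimage_closed (f := g)) => // x _; exact: gcont.
  move=> x y t Bx By t0 t1; have := cB _ _ _ Bx By t0 t1; rewrite /B1 /=.
  congr B; apply/rowP => j; rewrite !mxE !(dotvBr, dotvDr, dotvZr); ring.
move=> z zint B1z; have [e e0 /(_ e)] := interior_radial (z - f) B1z.
rewrite gtr0_norm // => /(_ (lexx _)) B1y.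
apply: (Bfree (g z)).
  apply: intvecD => //; apply/intvecN/intvecZ => //.
  by rewrite dotvBr rpredB // dotv_int.
apply: (interior_pushed cB Bf e0); move: B1y; rewrite /B1 /=; congr B.
apply/rowP => j; rewrite /g !mxE !(dotvBr, dotvDr, dotvZr); ring.
Qed.

(** Dividing [u] by a nonzero integer cannot increase the extent of [B]; [w] certifies that the
    quotient is primitive. *)
Lemma primitive_flat_direction (R : realType) n (B : set 'rV[R]_n.+1) (u : 'rV[R]_n.+1) (F : R) :
  intvec u -> u != 0 -> (forall x y, B x -> B y -> dotv u x - dotv u y <= F) ->
  exists v w, [/\ intvec v, intvec w, dotv v w = 1 &
    forall x y, B x -> B y -> dotv v x - dotv v y <= F].
Proof.
move=> uint u0 Bu; have [e [y [d [eint yint ye dint ude]]]] := unimodular_frame uint.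
exists (e ord0), (y ord0); split => //; first by rewrite dotvC ye.
move=> x x' Bx Bx'; have := Bu _ _ Bx Bx'; have := Bu _ _ Bx' Bx.
rewrite ude !dotvZl; have [d0|d0|d0] := ltgtP d 0; last by move: u0; rewrite ude d0 scale0r eqxx.
- by have := int_ltD1 dint (rpred0 _) d0; nra.
- by have := int_ltD1 (rpred0 _) dint d0; nra.
Qed.

(* Induction on the codimension [k] of the lineality space of [B]; the section of [B] by
   [u x = u f] is thickened along an integer direction [w] with [u w = 1], which enlarges the
   lineality space while [B] stays lattice-free of full dimension. *)
Lemma lattice_free_enclosure (R : realType) n (f : 'rV[R]_n.+1) (s : nat) (F : R) :
  (0 < s)%N -> intvec (s%:R *: f) -> 0 < F ->
  (forall B : set 'rV[R]_n.+1, lattice_free B -> exists u, [/\ intvec u, u != 0 &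
     forall x y, B x -> B y -> dotv u x - dotv u y <= F]) ->
  forall k r (B : set 'rV[R]_n.+1) (W : 'M[R]_(r, n.+1)),
  (r + k)%N = n.+1 -> row_free W ->
  (forall v x, (v <= W)%MS -> B x -> B (x + v)) -> lattice_free B -> B° f ->
  exists m (A : 'I_m -> 'rV[R]_n.+1), [/\ (m <= k.+1)%N, integer_free f A, balanced A &
    forall x j, B x -> dotv (A j) (x - f) <= F * (s%:R + k%:R - 1)].
Proof.
move=> s0 sf F0 flat; have s1 : 1 <= s%:R :> R by rewrite ler1n.
elim=> [|k IH] r B W rk Wfree Wlin Blf Bf.
  (* At [k = 0] the lineality space is everything, so [B] would contain [0] in its interior. *)
  exfalso; case: (Blf) => _ /(_ 0); apply => [j|]; first by rewrite mxE rpred0.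
  suff -> : B = setT by rewrite interiorT.
  apply/seteqP; split => // x _; rewrite -(subrK f x) addrC.
  apply: Wlin; last exact: interior_subset Bf.
  by apply: submx_full; rewrite /row_full (eqP Wfree) -rk addn0.
have [u0 [u0int u00 Bu0]] := flat B Blf.
have [u [w [uint wint uw Bu]]] := primitive_flat_direction u0int u00 Bu0.
have Bff := interior_subset Bf.
have Bu1 x : B x -> dotv u (x - f) <= F by move=> Bx; rewrite dotvBr; exact: Bu.
have Bu2 x : B x -> - F <= dotv u (x - f).
  by move=> Bx; have := Bu _ _ Bff Bx; rewrite dotvBr; lra.
have k1 : (0 : R) <= k%:R by [].
have kE : k.+1%:R = k%:R + 1 :> R by rewrite natr1.
have [ufint|ufnint] := boolP (dotv u f \is a Num.int); last first.
  pose p := dotv u f - (Num.floor (dotv u f))%:~R.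
  have fl := floor_itv (dotv u f).
  have p0 : 0 < p.
    rewrite lt_neqAle eq_sym subr_eq0 eq_sym -intrEfloor ufnint /=.
    by rewrite subr_ge0; case/andP: fl.
  have p1 : p < 1 by rewrite ltrBlDl -intrD1; case/andP: fl.
  have sp : s%:R * p \is a Num.int.
    by rewrite mulrBr -dotvZr rpredB ?dotv_int // rpredM ?rpred_nat ?intr_int.
  (* Applied to [p] and [1 - p], positive multiples of [1 / s], to bound the scaling of the split by
     [s]. *)
  have le1 (q : R) : 0 < q -> s%:R * q \is a Num.int -> q^-1 <= s%:R.
    move=> q0 /(int_ltD1 (rpred0 _)); rewrite mulr_gt0 ?ltr0n // add0r => /(_ isT).
    by rewrite -ler_pdivrMr // mul1r.
  have q0 : 0 < 1 - p by lra.
  have i1 : p^-1 <= s%:R by exact: le1.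
  have i2 : (1 - p)^-1 <= s%:R by apply: le1 => //; rewrite mulrBr mulr1 rpredB ?rpred_nat.
  have p01 : 0 < p < 1 by rewrite p0.
  have [|Sfree Sbal] := split_systemP (f := f) (u := u) (p := p) uint p01.
    by rewrite opprB addrC subrK intr_int.
  have ip0 : 0 < p^-1 by rewrite invr_gt0.
  have iq0 : 0 < (1 - p)^-1 by rewrite invr_gt0.
  exists 2%N, (split_system u p); split => // x j Bx.
  have b1 := Bu1 x Bx; have b2 := Bu2 x Bx.
  have Fs : F * s%:R <= F * (s%:R + k.+1%:R - 1) by rewrite ler_pM2l // kE; lra.
  apply: le_trans Fs; rewrite /split_system; case: ifP => _; rewrite dotvZl.
    apply: (@le_trans _ _ ((1 - p)^-1 * F)); first by rewrite ler_pM2l.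
    by rewrite mulrC ler_pM2l.
  apply: (@le_trans _ _ (p^-1 * F)); first by rewrite mulNr -mulrN ler_pM2l //; lra.
  by rewrite mulrC ler_pM2l.
have Wu v : (v <= W)%MS -> dotv u v = 0.
  move=> vW; apply/eqP; apply/negPn/negP => uv0.
  have := Bu1 _ (Wlin ((2 * F / dotv u v) *: v) f (scalemx_sub _ vW) Bff).
  by rewrite addrAC subrr add0r dotvZr divfK //; lra.
have [B1lf B1f] := flattening_lattice_free Blf Bf uint wint uw ufint.
set B1 := [set x | _] in B1lf B1f.
have W1free : row_free (col_mx w W).
  apply: inj_row_free => v; rewrite -[v]hsubmxK mul_row_col.
  set a := lsubmx v; set b := rsubmx v => ab0.
  have a0 : a = 0.
    have := dotv0r u; rewrite -ab0 dotvDr (Wu _ (submxMl _ _)) addr0.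
    by rewrite (mx11_scalar a) mul_scalar_mx dotvZr uw mulr1 => ->; rewrite raddf0.
  move: ab0; rewrite a0 mul0mx add0r => /eqP.
  by rewrite mulmx_free_eq0 // => /eqP ->; rewrite row_mx0.
have W1lin v x : (v <= col_mx w W)%MS -> B1 x -> B1 (x + v).
  move=> /submxP[D ->]; rewrite -[D]hsubmxK mul_row_col.
  set a := lsubmx D; set b := rsubmx D; rewrite /B1 /= => B1x.
  rewrite (mx11_scalar a) mul_scalar_mx; set c := a 0 0.
  have bW : (b *m W <= W)%MS by exact: submxMl.
  have := Wlin _ _ bW B1x; congr B.
  rewrite addrAC [x + _ - f]addrAC.
  rewrite !dotvDr (Wu _ bW) dotvZr uw mulr1.
  by apply/rowP => j; rewrite !mxE; ring.
have rk1 : (1 + r + k)%N = n.+1 by rewrite -rk addnS add1n addSn.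
have [m [A [mk Afree [l [l0 l1 lA]] AB]]] := IH _ _ _ rk1 W1free W1lin B1lf B1f.
have un0 : u != 0 by apply/eqP => u0E; move: uw; rewrite u0E dotv0l => /eqP; rewrite eq_sym oner_eq0.
have cB : Defs.convex_set B by case: Blf => -[].
(* [B] and [B1] share the section through [f], so the inequalities found for [B1] hold on all of [B]
   after tilting along [u]. *)
have /choice[c cP] : forall j, exists c, forall x, B x ->
    dotv (A j) (x - f) + c * dotv u (x - f) <= F * (s%:R + k%:R - 1).
  move=> j; apply: extend_bound => // x Bx ux; apply: AB.
  by rewrite /B1 /= ux scale0r subr0.
(* Reversing [u] and [c] together makes the weighted sum of the tilts nonpositive. *)
have [v [d [vint vfint Bv dP ld]]] : exists v d, [/\ intvec v, dotv v f \is a Num.int,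
    forall x, B x -> `|dotv v (x - f)| <= F,
    forall j x, B x -> dotv (A j) (x - f) + d j * dotv v (x - f) <= F * (s%:R + k%:R - 1) &
    \sum_j l j * d j <= 0].
  have [lc|lc] := leP (\sum_j l j * c j) 0.
    by exists u, c; split => // x Bx; rewrite ler_norml Bu2 ?Bu1.
  exists (- u), (fun j => - c j); split => //.
  - exact: intvecN.
  - by rewrite dotvNl rpredN.
  - by move=> x Bx; rewrite dotvNl normrN ler_norml Bu2 ?Bu1.
  - by move=> j x Bx; rewrite dotvNl mulrNN cP.
  - rewrite (eq_bigr (fun j => - (l j * c j))) => [|j _]; last by rewrite mulrN.
    by rewrite sumrN oppr_le0 ltW.
(* Lowering every tilt by [1] reaches the threshold of the lifting and costs at most [F] per
   induction step, whence the [k] in the bound. *)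
have ld1 : \sum_j l j * (d j - 1) <= -1.
  rewrite (eq_bigr (fun j => l j * d j - l j)) => [|j _]; last by ring.
  by rewrite sumrB l1; lra.
have [Lfree Lbal] := lift_systemP Afree l0 l1 lA vint vfint ld1.
exists m.+1, (lift_system A (fun j => d j - 1) v); split => // x j Bx.
have := Bv x Bx; rewrite ler_norml => /andP[v1 v2]; rewrite kE.
have Fk : 0 <= F * k%:R by rewrite mulr_ge0 // ltW.
rewrite /lift_system; case: unliftP => [i _|_].
  by rewrite dotvDl dotvZl; have := dP i x Bx; lra.
have : F * 1 <= F * s%:R by rewrite ler_pM2l.
lra.
Qed.

(** * Gauges and the finite bound on [rho] *)

Lemma gauge_nonempty (R : realType) n (B : set 'rV[R]_n) (f r : 'rV[R]_n) :
  B° f -> [set l : R | 0 < l /\ exists b, B b /\ r = l *: (b - f)] !=set0.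
Proof.
move=> Bf; have [e e0 /(_ e)] := interior_radial r Bf.
rewrite gtr0_norm // => /(_ (lexx _)) Be; exists e^-1; split; first by rewrite invr_gt0.
by exists (f + e *: r); split => //; rewrite addrAC subrr add0r scalerA mulVf ?scale1r ?gt_eqF.
Qed.

Lemma gauge_has_lbound (R : realType) n (B : set 'rV[R]_n) (f r : 'rV[R]_n) :
  has_lbound [set l : R | 0 < l /\ exists b, B b /\ r = l *: (b - f)].
Proof. by exists 0 => l [/ltW]. Qed.

Lemma gauge_ge0 (R : realType) n (B : set 'rV[R]_n) (f r : 'rV[R]_n) :
  B° f -> 0 <= gauge B f r.
Proof. by move=> Bf; apply: lb_le_inf; [exact: gauge_nonempty|move=> l [/ltW]]. Qed.

Lemma gauge_dilate (R : realType) n (B L : set 'rV[R]_n) (f r : 'rV[R]_n) (alpha : R) :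
  0 < alpha -> B° f -> (forall x, B x -> L (f + alpha^-1 *: (x - f))) ->
  gauge L f r <= alpha * gauge B f r.
Proof.
move=> a0 Bf BL; rewrite mulrC -ler_pdivrMr //.
apply: lb_le_inf; first exact: gauge_nonempty.
move=> l [l0 [b [Bb rE]]]; rewrite ler_pdivrMr //; apply: ge_inf.
  exact: gauge_has_lbound.
split; first by rewrite mulr_gt0.
exists (f + alpha^-1 *: (b - f)); split; first exact: BL.
by rewrite rE addrAC subrr add0r scalerA mulfK // gt_eqF.
Qed.

(** If the cut of [L] holds at [t], the cut of [B] holds at [alpha *: t], because the gauge of [L]
    is at most [alpha] times that of [B]. *)
Lemma rho_le (R : realType) n (f : 'rV[R]_n) (Bs Ls : set (set 'rV[R]_n)) (alpha : R) :
  0 < alpha ->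
  (forall B, Ls B -> B° f -> exists L, [/\ Bs L, L° f &
     forall x, B x -> L (f + alpha^-1 *: (x - f))]) ->
  (rho f Bs Ls <= alpha%:E)%E.
Proof.
move=> a0 encl; apply: ereal_inf_lbound; exists alpha => //; split => // k r t [t0 tBs].
exists (alpha *: t); last by rewrite scalerA mulVf ?scale1r // gt_eqF.
have at0 j : 0 <= (alpha *: t) 0 j by rewrite mxE mulr_ge0 // ltW.
split => // B LsB; rewrite /CB; case: asboolP => // Bf; split => //.
have [L [BsL Lf BL]] := encl B LsB Bf.
have := tBs L BsL; rewrite /CB; case: asboolP => // _ [_ tL].
apply: le_trans tL _; apply: ler_sum => j _.
by rewrite mxE -mulrA mulrCA ler_wpM2l // gauge_dilate.
Qed.

(** The strict inequality yields a direction even if the infimum is not attained. *)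
Lemma lattice_width_le (R : realType) n (B : set 'rV[R]_n) (F : R) :
  (lattice_width B < F%:E)%E -> exists u, [/\ intvec u, u != 0 &
    forall x y, B x -> B y -> dotv u x - dotv u y <= F].
Proof.
move=> /ereal_inf_lt[_ [u [uint u0] <-] uF]; exists u; split => // x y Bx By.
rewrite -lee_fin EFinB; apply: le_trans (ltW uF).
by apply: leeB; [apply: ereal_sup_ubound; exists x|apply: ereal_inf_lbound; exists y].
Qed.

(** A nonempty split around half a unit vector keeps the supremum from being [-oo]. *)
Lemma Flt_ge0 (R : realType) n : (0 <= Flt R n.+1)%E.
Proof.
pose u : 'rV[R]_n.+1 := delta_mx 0 0; pose f := 2^-1 *: u.
have uint : intvec u by move=> j; rewrite mxE; case: (_ && _).
have uu : dotv u u = 1.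
  rewrite /dotv (bigD1 ord0) //= !mxE eqxx mulr1 big1 ?addr0 // => j /negPf j0.
  by rewrite !mxE eqxx /= j0 mulr0.
have p01 : 0 < (2^-1 : R) < 1 by lra.
have [|Sfree _] := split_systemP (f := f) (u := u) (p := 2^-1) uint p01.
  by rewrite dotvZr uu mulr1 subrr rpred0.
apply: (@le_trans _ _ (lattice_width (cap f (split_system u (2^-1))))); last first.
  by apply: ereal_sup_ubound; exists (cap f (split_system u 2^-1)) => //; exact: cap_lattice_free.
apply: le_ereal_inf_tmp => _ [v _ <-].
have capf : cap f (split_system u 2^-1) f by exact: interior_subset (interior_cap_center _ _).
have <- : ((dotv v f)%:E - (dotv v f)%:E = 0 :> \bar R)%E by rewrite -EFinB subrr.
by apply: leeB; [apply: ereal_sup_ubound; exists f|apply: ereal_inf_lbound; exists f].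
Qed.

(** The enclosure starts from a zero lineality space, so [k] is [n.+1]: at most [n.+2] inequalities,
    and the factor [F * (s + k - 1)] is [F * (s + n)]. *)
Lemma rho_Lfam_Lstar (R : realType) n i (f : 'rV[R]_n.+1) (s : nat) (F : R) :
  (n.+1 < i)%N -> (0 < s)%N -> intvec (s%:R *: f) -> 0 < F -> (Flt R n.+1 < F%:E)%E ->
  (rho f (@Lfam R n.+1 i) (@Lstar R n.+1) <= (F * (s%:R + n%:R))%:E)%E.
Proof.
move=> ni s0 sf F0 FltF.
have a0 : 0 < F * (s%:R + n%:R) by rewrite mulr_gt0 // ltr_wpDr // ltr0n.
apply: rho_le => // B [Blf _] Bf.
have flat (C : set 'rV[R]_n.+1) : lattice_free C -> exists u, [/\ intvec u, u != 0 &
    forall x y, C x -> C y -> dotv u x - dotv u y <= F].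
  move=> Clf; apply: lattice_width_le; apply: le_lt_trans FltF.
  by apply: ereal_sup_ubound; exists C.
have [||m [A [mk Afree _ AB]]] :=
    lattice_free_enclosure s0 sf F0 flat (W := (0 : 'M[R]_(0, n.+1))) (erefl n.+1) _ _ Blf Bf.
- by rewrite /row_free mxrank0.
- by move=> v x /submxP[D ->]; rewrite (thinmx0 D) mul0mx addr0.
exists (cap f A); split; first by apply: cap_Lfam => //; exact: leq_trans ni.
  exact: interior_cap_center.
move=> x Bx j; rewrite addrAC subrr add0r dotvZr mulrC ler_pdivrMr // mul1r.
by apply: le_trans (AB x j Bx) _; rewrite -natr1; lra.
Qed.

(** * The infinite case: polyhedra with few facets against flat pyramids *)

Lemma polyhedron_cap (R : realType) n (P : set 'rV[R]_n) (f : 'rV[R]_n) :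
  polyhedron P -> P° f -> exists m (A : 'I_m -> 'rV[R]_n), P = cap f A.
Proof.
move=> [m [a [b PE]]] Pf.
have Pff : P f by exact: interior_subset Pf.
have slack j : a j != 0 -> dotv (a j) f < b j.
  move=> a0; have [e e0 /(_ e)] := interior_radial (a j) Pf.
  rewrite gtr0_norm // PE => /(_ (lexx _)) /(_ j); rewrite dotvDr dotvZr.
  by have := dotvv_gt0 a0; nra.
(* Each inequality is divided by its slack at [f]; one with zero normal becomes [0 <= 1], whatever
   its slack. *)
exists m, (fun j => (b j - dotv (a j) f)^-1 *: a j).
rewrite PE; apply/seteqP; split => x /= xP j; have := xP j; rewrite dotvZl dotvBr.
  have [->|/slack aj] := eqVneq (a j) 0; first by rewrite !dotv0l subrr mulr0.
  by move=> ?; rewrite mulrC ler_pdivrMr ?subr_gt0 //; lra.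
have [a0 _|/slack aj] := eqVneq (a j) 0.
  by move: Pff; rewrite PE => /(_ j); rewrite a0 !dotv0l.
by rewrite mulrC ler_pdivrMr ?subr_gt0 //; lra.
Qed.

Lemma facet_of_witness (R : realType) n (f : 'rV[R]_n) m (A : 'I_m -> 'rV[R]_n) j
    (y : 'rV[R]_n) :
  dotv (A j) (y - f) = 1 -> (forall k, k != j -> dotv (A k) (y - f) < 1) ->
  facet (cap f A) [set x | cap f A x /\ dotv (A j) (x - f) = 1].
Proof.
move=> yj yk.
have Aj0 : A j != 0.
  by apply/eqP => A0; move: yj; rewrite A0 dotv0l => /eqP; rewrite eq_sym oner_eq0.
have capE x : (forall k, k != j -> dotv (A k) (x - f) <= 1) ->
    dotv (A j) (x - f) = 1 -> cap f A x.
  by move=> xk xj k; have [->|/xk] := eqVneq k j; rewrite ?xj.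
exists (A j), (1 + dotv (A j) f); split => //.
- by move=> x /(_ j); rewrite dotvBr lerBlDr.
- by apply/seteqP; split => x [xP xj]; split => //; move: xj; rewrite dotvBr; lra.
pose K := kermx (A j)^T.
have rk : \rank K = n.-1.
  by rewrite mxrank_ker mxrank_tr rank_rV Aj0 subn1.
rewrite -rk; apply: (@affdim_ge_directions _ _ _ _ y (row_base K)).
- by split => //; apply: capE => // k kj; exact/ltW/yk.
- exact: row_base_free.
move=> i; set v := row i _.
have vK : dotv (A j) v = 0.
  rewrite dotvC dotvE; have /sub_kermxP -> : (v <= K)%MS; last by rewrite mxE.
  by apply: submx_trans (row_sub _ _) _; rewrite eq_row_base.
(* Inequality [j] becomes [0 <= 1], which makes [y] interior and lets it move along the kernel of
   [A j]. *)
pose A' k := if k == j then 0 else A k.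
have [|e e0 /(_ e)] := @interior_radial _ _ (cap f A') y v.
  apply: interior_cap => k; rewrite /A'; case: eqVneq => [_|/yk //].
  by rewrite dotv0l ltr01.
rewrite gtr0_norm // => /(_ (lexx _)) A'y; exists e => //.
have yj' : dotv (A j) (y + e *: v - f) = 1.
  by rewrite addrAC dotvDr dotvZr vK mulr0 addr0.
by split => //; apply: capE => // k kj; have := A'y k; rewrite /A' (negPf kj).
Qed.

(* In a description with the fewest inequalities every inequality defines a facet of its own. *)
Lemma at_most_facets_cap (R : realType) n (P : set 'rV[R]_n) (f : 'rV[R]_n) i :
  polyhedron P -> P° f -> at_most_facets P i ->
  exists m (A : 'I_m -> 'rV[R]_n), (m <= i)%N /\ P = cap f A.
Proof.
move=> Ppoly Pf Pfacets.
have exm : exists m, `[< exists A : 'I_m -> 'rV[R]_n, P = cap f A >].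
  by have [m [A PE]] := polyhedron_cap Ppoly Pf; exists m; apply/asboolP; exists A.
case: (ex_minnP exm) => m /asboolP[A PE] minm; exists m, A; split => //.
have /choice[y yP] : forall j, exists y, dotv (A j) (y - f) = 1 /\
    forall k, k != j -> dotv (A k) (y - f) < 1.
  move=> j.
  have [x [xj xk]] : exists x, 1 < dotv (A j) (x - f) /\
      forall k, k != j -> dotv (A k) (x - f) <= 1.
    apply: contrapT => /forallNP nox.
    case: m => [|m] in A PE minm j nox *; first by case: (j).
    suff /minm : `[< exists A' : 'I_m -> 'rV[R]_n, P = cap f A' >] by rewrite ltnn.
    apply/asboolP; exists (fun k => A (lift j k)); rewrite PE.
    apply/seteqP; split => x xA k; first exact: xA.
    have xk l : l != j -> dotv (A l) (x - f) <= 1.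
      by rewrite eq_sym => /unlift_some[l' -> _]; exact: xA.
    have [->|/xk //] := eqVneq k j.
    by rewrite leNgt; apply/negP => xj; exact: (nox x).
  have x0 : 0 < dotv (A j) (x - f) by lra.
  set t := dotv (A j) (x - f) in xj x0.
  (* Shrinking towards [f] by the factor [t > 1] makes inequality [j] tight and the others
     strict. *)
  exists (f + t^-1 *: (x - f)); rewrite addrAC subrr add0r; split.
    by rewrite dotvZr mulVf // gt_eqF.
  by move=> k kj; rewrite dotvZr mulrC ltr_pdivrMr // mul1r; apply: le_lt_trans xj; exact: xk.
rewrite leqNgt; apply/negP => mi.
have [|j1 [j2 [j12 F12]]] := Pfacets (fun k =>
    [set x | cap f A x /\ dotv (A (widen_ord mi k)) (x - f) = 1]).
  move=> k; rewrite PE; have [yj yk] := yP (widen_ord mi k).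
  exact: facet_of_witness yj yk.
have [yj yk] := yP (widen_ord mi j1).
have : [set x | cap f A x /\ dotv (A (widen_ord mi j2)) (x - f) = 1] (y (widen_ord mi j1)).
  rewrite -F12; split => // k; have [->|/yk/ltW //] := eqVneq k (widen_ord mi j1).
  by rewrite yj.
move=> [_ y2]; have := yk (widen_ord mi j2); rewrite y2 ltxx.
have -> // : widen_ord mi j2 != widen_ord mi j1.
  by rewrite -val_eqE /= val_eqE eq_sym.
by move=> /(_ isT).
Qed.

(* [b] describes a simplex whose gauge is at most [1] on the rays [r], while a system [As] of one
   inequality less with gauge at most [M] on all rays has a point of [Z] in its interior. The bound
   [C] says, without naming coefficients, that [- r k] and [z - f], for [z] in [Z], are nonnegative
   combinations of the rays. The step passes to the pyramid with base at height [-1] and apex at the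
   small height [1 / kappa] above [f]. *)
Lemma blocking_simplex (R : realType) n (f : 'rV[R]_n.+1) (e y : 'I_n.+1 -> 'rV[R]_n.+1) (c M : R) :
  (forall j, intvec (e j)) -> (forall j, intvec (y j)) ->
  (forall j k, dotv (y j) (e k) = (j == k)%:R) ->
  f = c *: e ord0 -> c \isn't a Num.int -> 0 <= M ->
  forall d, (d < n.+1)%N ->
  exists (b r : 'I_d.+2 -> 'rV[R]_n.+1) (Z : set 'rV[R]_n.+1) (C : R),
    [/\ integer_free f b /\ balanced b, forall j k, dotv (b j) (r k) <= 1,
        forall As : seq 'rV[R]_n.+1, (size As <= d.+1)%N ->
          (forall a k, a \in As -> dotv a (r k) <= M) ->
          exists z, [/\ intvec z, Z z & forall a, a \in As -> dotv a (z - f) < 1],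
        0 <= C /\ (forall a eta, 0 <= eta -> (forall k, dotv a (r k) <= eta) ->
          (forall k, - (C * eta) <= dotv a (r k)) /\
          (forall z, Z z -> dotv a (z - f) <= C * eta)) &
        forall j : 'I_n.+1, (d < j)%N -> forall k, dotv (y j) (r k) = 0 /\ dotv (b k) (e j) = 0].
Proof.
move=> eint yint ye fE cnint M0.
have yf j : dotv (y j) f = c * (j == ord0)%:R by rewrite fE dotvZr ye.
have yf0 : dotv (y ord0) f = c by rewrite yf eqxx mulr1.
elim=> [|d IH] dn.
  pose p := c - (Num.floor c)%:~R.
  have fl := floor_itv c.
  have p0 : 0 < p.
    rewrite lt_neqAle eq_sym subr_eq0 eq_sym -intrEfloor cnint /=.
    by rewrite subr_ge0; case/andP: fl.
  have p1 : p < 1 by rewrite ltrBlDl -intrD1; case/andP: fl.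
  have q0 : 0 < 1 - p by lra.
  have p01 : 0 < p < 1 by rewrite p0.
  have cp : c - p \is a Num.int by rewrite opprB addrC subrK intr_int.
  have bP := split_systemP (f := f) (u := y ord0) (p := p) (yint _) p01.
  rewrite yf0 in bP; have {}bP := bP cp.
  (* The points [f + r k] are the two integer neighbours of [f] on the axis. *)
  pose r (k : 'I_2) := if k == ord0 then (1 - p) *: e ord0 else - p *: e ord0.
  have r0 : r ord0 = (1 - p) *: e ord0 by rewrite /r eqxx.
  have r1 : r (lift ord0 ord0) = - p *: e ord0 by [].
  pose Z := [set z | exists k, z = f + r k].
  have Zint k : intvec (f + r k).
    rewrite /r fE; case: ifP => _; rewrite -scalerDl; apply: intvecZ => //.
    by rewrite addrCA rpredD // rpred1.
  exists (split_system (y ord0) p), r, Z, (p^-1 + (1 - p)^-1).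
  have yy : dotv (y ord0) (e ord0) = 1 by rewrite ye eqxx.
  have ip0 : 0 < p^-1 by rewrite invr_gt0.
  have iq0 : 0 < (1 - p)^-1 by rewrite invr_gt0.
  have pp : p * p^-1 = 1 by rewrite divff // gt_eqF.
  have qq : (1 - p) * (1 - p)^-1 = 1 by rewrite divff // gt_eqF.
  split => //.
  - move=> j k; rewrite /split_system /r; case: ifP => _; case: ifP => _;
      rewrite dotvZl dotvZr yy mulr1.
    + by rewrite mulVf // gt_eqF.
    + by rewrite mulrN; have := mulr_gt0 iq0 p0; lra.
    + by rewrite mulNr; have := mulr_gt0 ip0 q0; lra.
    + by rewrite mulrNN mulVf // gt_eqF.
  - move=> [|a [|]] //= _ aM.
      by exists (f + r ord0); split => //; exists ord0.
    have [ae|ae] := leP (dotv a (e ord0)) 0.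
      exists (f + r ord0); split => //; first by exists ord0.
      by move=> _ /[!inE] /eqP ->; rewrite addrAC subrr add0r r0 dotvZr; nra.
    exists (f + r (lift ord0 ord0)); split => //; first by exists (lift ord0 ord0).
    by move=> _ /[!inE] /eqP ->; rewrite addrAC subrr add0r r1 dotvZr; nra.
  - split; first by rewrite addr_ge0 // ltW.
    move=> a eta eta0 ar.
    have a0 := ar ord0; have a1 := ar (lift ord0 ord0).
    rewrite r0 dotvZr in a0; rewrite r1 dotvZr in a1.
    have A0 : dotv a (e ord0) <= (1 - p)^-1 * eta.
      by rewrite mulrC ler_pdivlMr //; lra.
    have A1 : - (p^-1 * eta) <= dotv a (e ord0).
      by rewrite lerNl mulrC ler_pdivlMr //; lra.
    have ie0 : 0 <= p^-1 * eta by rewrite mulr_ge0 // ltW.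
    have ie1 : 0 <= (1 - p)^-1 * eta by rewrite mulr_ge0 // ltW.
    split=> [k|_ [k ->]].
      by rewrite /r; case: ifP => _; rewrite dotvZr; nra.
    rewrite addrAC subrr add0r; apply: le_trans (ar k) _.
    have : 1 <= p^-1 by rewrite invf_ge1 // ltW.
    by nra.
  - move=> j j0 k; rewrite /r /split_system.
    have j0' : j != ord0 by rewrite -val_eqE /= -lt0n.
    have z1 : dotv (y j) (e ord0) = 0 by rewrite ye (negPf j0').
    have z2 : dotv (y ord0) (e j) = 0 by rewrite ye eq_sym (negPf j0').
    by case: ifP => _; rewrite dotvZr dotvZl z1 z2 !mulr0.
have [b [q [Z [C [[bfree [l [l0 l1 lb]]] bq Zblock [C0 Cbound] orth]]]]] := IH (ltnW dn).
pose E := e (Ordinal dn); pose Y := y (Ordinal dn).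
have YE : dotv Y E = 1 by rewrite ye eqxx.
have Yf : dotv Y f = 0 by rewrite yf -val_eqE /= mulr0.
have Yq k : dotv Y (q k) = 0 by case: (orth (Ordinal dn) (ltnSn d) k).
have bE k : dotv (b k) E = 0 by case: (orth (Ordinal dn) (ltnSn d) k).
have [|//|z0 [z0int Zz0 _]] := Zblock [::]; first by [].
(* Chosen so that [C * (M + 1) < kappa + 1]: an inequality with [dotv a E <= 1] is then strict on
   all of [Z]. *)
pose kappa := 1 + C * (M + 1).
have CM : 0 <= C * (M + 1) by rewrite mulr_ge0 // addr_ge0.
have k1 : 1 <= kappa by rewrite lerDl.
have k0 : 0 < kappa by lra.
(* Going down [N] steps along [E] absorbs [C * M] when every inequality has [dotv a E > 1]. *)
pose N : R := (Num.ceil (C * M))%:~R.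
have NCM : C * M <= N by exact: ceil_ge.
have N0 : 0 <= N by apply: le_trans NCM; exact: mulr_ge0.
(* By similar triangles, the section spanned by [q] at height [0], under an apex at height
   [1 / kappa], is enlarged by [kappa + 1] at height [-1]. *)
pose r k := if unlift ord0 k is Some k' then (kappa + 1) *: q k' - E else kappa^-1 *: E.
have r0 : r ord0 = kappa^-1 *: E by rewrite /r unlift_none.
have rS k : r (lift ord0 k) = (kappa + 1) *: q k - E by rewrite /r liftK.
have ray a eta : (forall k, dotv a (r k) <= eta) ->
    [/\ dotv a E <= kappa * eta, forall k, (kappa + 1) * dotv a (q k) <= eta + dotv a E &
        forall k, dotv a (q k) <= eta].
  move=> ar.
  have aE : dotv a E <= kappa * eta.
    by have := ar ord0; rewrite r0 dotvZr mulrC ler_pdivrMr // mulrC.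
  have aq k : (kappa + 1) * dotv a (q k) <= eta + dotv a E.
    by have := ar (lift ord0 k); rewrite rS dotvBr dotvZr lerBlDr.
  split=> // k; have kp : 0 < kappa + 1 by lra.
  by rewrite -(ler_pM2l kp); apply: le_trans (aq k) _; lra.
pose L := (kappa + 1) * C.
have L0 : 0 <= L by rewrite mulr_ge0 // ltW //; lra.
have NL : 0 <= N * (L + 1) by rewrite mulr_ge0 // addr_ge0.
(* The last witness sums crude bounds for the rays, for [Z] and for the new point [z0 - N *: E]. *)
exists (lift_system b (fun=> - kappa) (- Y)), r, [set z | Z z \/ z = z0 - N *: E],
  (L + kappa + 1 + C + N * (L + 1)).
split.
- apply: (lift_systemP bfree l0 l1 lb).
  + exact/intvecN/yint.
  + by rewrite dotvNl Yf oppr0 rpred0.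
  + by rewrite -mulr_suml l1 mul1r lerN2.
- move=> j k; rewrite /lift_system.
  case: (unliftP ord0 j) => [j' _|_]; case: (unliftP ord0 k) => [k' ->|->]; rewrite ?r0 ?rS.
  + rewrite scaleNr scalerN opprK dotvDl !dotvZl !dotvBr !dotvZr Yq YE bE.
    by have := bq j' k'; nra.
  + rewrite scaleNr scalerN opprK dotvDl !dotvZl !dotvZr YE bE.
    by rewrite mulr1 mulr0 add0r divff // gt_eqF.
  + by rewrite dotvNl dotvBr dotvZr Yq YE; lra.
  + rewrite dotvNl dotvZr YE mulr1; apply: le_trans ler01.
    by rewrite oppr_le0 invr_ge0 ltW.
- move=> As sAs AsM.
  (* An inequality of small slope along [E] is set aside for the induction hypothesis and recovered
     through [kappa]; if there is none, [z0] is lowered. *)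
  have [/hasP[a0 a0As a0E]|/hasPn allE] := boolP (has (fun a => dotv a E <= 1) As).
    have [||z [zint Zz zlt]] := Zblock (rem a0 As).
    + by rewrite size_rem // -subn1 leq_subLR add1n.
    + by move=> a k /mem_rem aAs; have [_ _] := ray a M (fun k => AsM a k aAs); apply.
    exists z; split => //; first by left.
    move=> a; rewrite (perm_mem (perm_to_rem a0As)) inE => /predU1P[->|]; last exact: zlt.
    have [_ a0q _] := ray a0 M (fun k => AsM a0 k a0As).
    have kp : 0 < kappa + 1 by lra.
    have eta0 : 0 <= (M + 1) / (kappa + 1) by apply: divr_ge0; lra.
    have [|_ /(_ z Zz) zb] := Cbound a0 ((M + 1) / (kappa + 1)) eta0.
      by move=> k; rewrite ler_pdivlMr // mulrC; apply: le_trans (a0q k) _; lra.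
    apply: le_lt_trans zb _; rewrite mulrA ltr_pdivrMr // /kappa; lra.
  exists (z0 - N *: E); split; last 1 first.
  + move=> a aAs; have aE := allE a aAs; rewrite -ltNge in aE.
    have [_ _ aq] := ray a M (fun k => AsM a k aAs).
    have [_ /(_ z0 Zz0) zb] := Cbound a M M0 aq.
    rewrite addrAC dotvBr dotvZr.
    have : N * 1 <= N * dotv a E by rewrite ler_wpM2l // ltW.
    lra.
  + by apply: intvecD => //; apply/intvecN/intvecZ; [exact: intr_int|exact: eint].
  + by right.
- split; first by rewrite !addr_ge0 // ltW.
  move=> a eta eta0 ar; have [aE aq1 aq2] := ray a eta ar.
  have [qlow zb] := Cbound a eta eta0 aq2.
  have Le : 0 <= L * eta by rewrite mulr_ge0.
  have ke : 0 <= kappa * eta by rewrite mulr_ge0 // ltW.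
  have Ce : 0 <= C * eta by rewrite mulr_ge0.
  have Ne : 0 <= N * (L + 1) * eta by rewrite mulr_ge0.
  have qlow' k : - (L * eta) <= (kappa + 1) * dotv a (q k).
    by rewrite -mulrA -mulrN ler_wpM2l //; lra.
  have Elow : - ((L + 1) * eta) <= dotv a E.
    by have := qlow' ord0; have := aq1 ord0; lra.
  split=> [k|z [Zz|->]].
  + case: (unliftP ord0 k) => [k' ->|->]; last first.
      rewrite r0 dotvZr [leRHS]mulrC ler_pdivlMr //.
      have : 0 <= (L + kappa + C + N * (L + 1)) * eta * (kappa - 1) + kappa * eta.
        by apply: addr_ge0 => //; apply: mulr_ge0; [apply: mulr_ge0 => //; lra|lra].
      have : 0 <= (kappa - 1 + C + N * (L + 1)) * eta by apply: mulr_ge0 => //; lra.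
      lra.
    by rewrite rS dotvBr dotvZr; have := qlow' k'; lra.
  + by have := zb z Zz; lra.
  + rewrite addrAC dotvBr dotvZr; have := zb z0 Zz0.
    have : N * (- ((L + 1) * eta)) <= N * dotv a E by rewrite ler_wpM2l.
    lra.
- move=> j dj k.
  have [yq be] : (forall k, dotv (y j) (q k) = 0) /\ (forall k, dotv (b k) (e j) = 0).
    by split => k'; case: (orth j (ltnW dj) k').
  have jE : j != Ordinal dn by rewrite -val_eqE /= neq_ltn dj orbT.
  have yE : dotv (y j) E = 0 by rewrite ye (negPf jE).
  have Ye : dotv Y (e j) = 0 by rewrite ye eq_sym (negPf jE).
  rewrite /lift_system; case: (unliftP ord0 k) => [k' ->|->]; rewrite ?r0 ?rS; split.
  + by rewrite dotvBr dotvZr yq yE mulr0 subr0.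
  + by rewrite dotvDl dotvZl dotvNl Ye be oppr0 mulr0 addr0.
  + by rewrite dotvZr yE mulr0.
  + by rewrite dotvNl Ye oppr0.
Qed.

(** A candidate [alpha] fails at the constant vector [M^-1]: each [L] around [f] has gauge at least
    [M] on some ray, while the simplex has gauge at most [1] on all rays and [M] exceeds [alpha]
    times their number. *)
Lemma rho_Lfam_infty (R : realType) n i (f : 'rV[R]_n.+1) :
  (2 <= i)%N -> (i <= n.+1)%N -> ratvec f -> ~ intvec f ->
  rho f (@Lfam R n.+1 i) (@Lfam R n.+1 i.+1) = +oo%E.
Proof.
move=> i2 i_n [s [s0 sf]] fnint.
have [e [y [d [eint yint ye dint sfE]]]] := unimodular_frame sf.
have fE : f = (d / s%:R) *: e ord0.
  by rewrite mulrC -scalerA -sfE scalerA mulVf ?scale1r // pnatr_eq0 -lt0n.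
have cnint : d / s%:R \isn't a Num.int.
  by apply/negP => cint; apply: fnint; rewrite fE; exact: intvecZ.
rewrite /rho; set S := [set a : R | _]; suff -> : S = set0 by rewrite image_set0 ereal_inf0.
apply/seteqP; split => // alpha [a0 alphaP].
case: i i2 i_n alphaP {S} => // d' _ dn alphaP.
pose M := alpha * d'.+2%:R + 1.
have aM : 0 < alpha * d'.+2%:R by rewrite mulr_gt0 // ltr0n.
have M0 : 0 < M by rewrite addr_gt0.
have [b [r [Z [C [[bfree _] br Zblock _ _]]]]] :=
  blocking_simplex eint yint ye fE cnint (ltW M0) dn.
pose t : 'rV[R]_d'.+2 := const_mx M^-1.
have t0 j : 0 <= t 0 j by rewrite mxE invr_ge0 ltW.
have /(alphaP _ r)[t' [t'0 t'B] tE] : Cfam (@Lfam R n.+1 d'.+1) r f t.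
  split=> // L [Llf Lpoly Lfacets]; rewrite /CB; case: asboolP => // Lf; split=> //.
  have [m [A [mi LE]]] := at_most_facets_cap Lpoly Lf Lfacets.
  have [j [k Ajk]] : exists j k, M < dotv (A j) (r k).
    apply: contrapT => noM.
    have [||z [zint _ zlt]] := Zblock [seq A j | j <- enum 'I_m].
    - by rewrite size_map size_enum_ord.
    - move=> _ k /mapP[j _ ->]; rewrite leNgt; apply/negP => Ajk.
      by apply: noM; exists j, k.
    case: Llf => _ /(_ z zint); apply; rewrite LE; apply: interior_cap => j.
    by apply: zlt; apply: map_f; rewrite mem_enum.
  have gk : M <= gauge L f (r k).
    apply: lb_le_inf; first exact: gauge_nonempty.
    move=> l [l0 [x [Lx rE]]]; move: Lx; rewrite LE => /(_ j) Ajx.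
    apply: le_trans (ltW Ajk) _; rewrite rE dotvZr.
    by rewrite -[leRHS]mulr1 ler_wpM2l // ltW.
  rewrite (bigD1 k) //= -[leLHS]addr0 lerD //.
    by rewrite mxE mulrC ler_pdivlMr // mul1r.
  by apply: sumr_ge0 => j' _; rewrite mulr_ge0 // gauge_ge0.
have := t'B _ (cap_Lfam (ltn0Sn n) (leqnn _) bfree).
rewrite /CB; case: asboolP => [_ [_]|nf _]; last by apply: nf; exact: interior_cap_center.
have -> : t' = alpha *: t by rewrite -tE scalerA divff ?scale1r // gt_eqF.
suff : \sum_(k < d'.+2) (alpha *: t) 0 k * gauge (cap f b) f (r k) < 1.
  by move=> /lt_le_trans h /h; rewrite ltxx.
apply: (@le_lt_trans _ _ (\sum_(k < d'.+2) alpha * M^-1)).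
  apply: ler_sum => k _; rewrite !mxE ler_piMr //.
    by apply: mulr_ge0; [exact: ltW|rewrite invr_ge0 ltW].
  apply: ge_inf; first exact: gauge_has_lbound.
  split=> //; exists (f + r k); split; last by rewrite addrAC subrr add0r scale1r.
  by move=> j; rewrite addrAC subrr add0r.
rewrite sumr_const card_ord -mulr_natr mulrAC ltr_pdivrMr // mul1r /M.
by rewrite ltrDl.
Qed.

Theorem theorem2p2 (R : realType) (n i : nat) (f : 'rV[R]_n) (s : nat) :
  (2 <= i)%N -> (i <= 2 ^ n)%N ->
  ratvec f -> ~ intvec f -> denominator_of f s ->
  ((i <= n)%N -> rho f (@Lfam R n i) (@Lfam R n i.+1) = +oo%E) /\
  ((n < i)%N ->
     (rho f (@Lfam R n i) (@Lstar R n) <= @Flt R n * (4 ^ n.-1)%:R%:E * s%:R%:E)%E).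
Proof.
move=> i2; case: n f => [|n] f i_n frat fnint [s0 sf _].
  (* Dimension [0] would force [i <= 1]. *)
  by move: i2; rewrite leqNgt ltnS i_n.
split=> ni; first exact: rho_Lfam_infty.
have F0 := Flt_ge0 R n; rewrite -muleA -EFinM.
set K : R := _ * s%:R.
(* Through [s + n <= n.+1 * s <= 4 ^ n * s], the ambient dimension being [n.+1]. *)
have sn : s%:R + n%:R <= K.
  rewrite /K -natrD -natrM ler_nat /=; apply: (@leq_trans (n.+1 * s)).
    by rewrite mulSn leq_add2l leq_pmulr.
  by rewrite leq_mul2r ltn_expl // orbT.
have s1 : 1 <= s%:R :> R by rewrite ler1n.
have n0 : 0 <= n%:R :> R by [].
have K0 : 0 < K by lra.
case FE : (Flt R n.+1) F0 => [F| |] // F0; last by rewrite gt0_mulye ?lte_fin // leey.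
rewrite lee_fin in F0.
(* The enclosure needs a value strictly above [Flt]; exceeding it by [eps / K] costs [eps]. *)
apply/lee_addgt0Pr => eps eps0.
have eK : 0 < eps / K by rewrite divr_gt0.
have Fe : 0 < F + eps / K by lra.
have FltFe : (Flt R n.+1 < (F + eps / K)%:E)%E by rewrite FE lte_fin ltrDl.
apply: le_trans (rho_Lfam_Lstar ni s0 sf Fe FltFe) _.
rewrite -EFinM -EFinD lee_fin.
apply: (@le_trans _ _ ((F + eps / K) * K)); first by rewrite ler_pM2l.
by rewrite mulrDl divfK // gt_eqF.
Qed.
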